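(* Let $d\ge1$ and let $m$ be a real number in $[-1/2,0)\cup(0,1]$. Then, for every $T>0$ and every smooth positive solution $h\in C^\infty([0,T]\times\mathbf{T}^d)$ to $\partial_th+\operatorname{div}(h\nabla\Delta h)=0$, one has for all $t\in[0,T]$ $$\frac{1}{m(m+1)}\frac{d}{dt}\int_{\mathbf{T}^d}h^{m+1}\,dx+C_m\int_{\mathbf{T}^d}h^{m-2}|\nabla h|^4\,dx\le0,$$ where $$C_m=\frac19\big(-2m^2+m+1\big)\ge0 .$$
   Context: $\mathbf{T}^d$ is a $d$-dimensional (flat) torus; $\nabla$, $\operatorname{div}$, $\Delta$ are taken with respect to $x\in\mathbf{T}^d$. *)

(* Defs.v *)
From HB Require Import structures.
From mathcomp Require Import all_boot all_order all_algebra.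
From mathcomp Require Import all_classical all_reals all_analysis.

Set Implicit Arguments.
Unset Strict Implicit.
Unset Printing Implicit Defensive.

Import Order.TTheory GRing.Theory Num.Theory.
Import numFieldNormedType.Exports.

Local Open Scope classical_set_scope.
Local Open Scope ring_scope.

(* A flat torus is R^d / L, where the lattice L is spanned by the rows of an
   invertible matrix A; functions on it are L-periodic functions on R^d. *)
Definition lattice_periodic (R : realType) (d : nat) (A : 'M[R]_d)
    (f : 'rV[R]_d -> R) : Prop :=
  forall (x : 'rV[R]_d) (i : 'I_d), f (x + row i A) = f x.

Fixpoint cube_integral (R : realType) (n : nat) : ('rV[R]_n -> R) -> R :=
  match n with
  | 0 => fun f => f 0
  | n'.+1 => fun f =>
      \int[@lebesgue_measure R]_(s in `[0, 1])
        cube_integral (fun y : 'rV[R]_n' => f (row_mx (const_mx s : 'rV[R]_1) y))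
  end.

(* Lebesgue integral over the fundamental parallelepiped {y A | y in [0,1]^d},
   in the lattice coordinates y. *)
Definition torus_integral (R : realType) (d : nat) (A : 'M[R]_d)
    (f : 'rV[R]_d -> R) : R :=
  `|\det A| * cube_integral (fun y => f (y *m A)).

Section space_derivatives.
Variables (R : realType) (d : nat).
Implicit Types (f : 'rV[R]_d -> R) (F : 'rV[R]_d -> 'rV[R]_d).

Definition partial (i : 'I_d) f (x : 'rV[R]_d) : R := 'D_(delta_mx 0 i) f x.

Definition grad f (x : 'rV[R]_d) : 'rV[R]_d := \row_i partial i f x.

Definition div F (x : 'rV[R]_d) : R :=
  \sum_(i < d) partial i (fun y => F y 0 i) x.

Definition laplacian f : 'rV[R]_d -> R := div (grad f).

(* The norm `|v| of the library on 'rV[R]_d is the sup norm. *)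
Definition euclidean_norm (v : 'rV[R]_d) : R :=
  Num.sqrt (\sum_(i < d) v 0 i ^+ 2).

End space_derivatives.

(* Derivative of a function on [0, T]: two-sided in the interior, one-sided at
   the endpoints. *)
Section time_derivative.
Variables (R : realType) (T : R).

Definition dt_quotient (g : R -> R) (t : R) : set_system R :=
  (fun s => (g s - g t) / (s - t)) @ within `[0, T] t^'.

Definition dt_derivable (g : R -> R) (t : R) : Prop := cvg (dt_quotient g t).

Definition dt (g : R -> R) (t : R) : R := lim (dt_quotient g t).

End time_derivative.

Section smooth.
Variables (R : realType) (d : nat) (T : R).

(* None is the time variable, Some i the i-th space variable. *)
Definition spacetime_partial (o : option 'I_d) (u : R -> 'rV[R]_d -> R) :
    R -> 'rV[R]_d -> R :=
  match o with
  | None => fun t x => dt T (fun s => u s x) t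
  | Some i => fun t x => partial i (u t) x
  end.

Definition continuous_with_partials (u : R -> 'rV[R]_d -> R) : Prop :=
  [/\ {within `[0, T] `*` [set: 'rV[R]_d],
        continuous (fun z : R * 'rV[R]_d => u z.1 z.2)},
      forall (t : R) (x : 'rV[R]_d), 0 <= t <= T -> dt_derivable T (fun s => u s x) t
    & forall (t : R) (x : 'rV[R]_d) (i : 'I_d), 0 <= t <= T -> derivable (u t) x (delta_mx 0 i)].

(* u is of class C^oo on [0, T] x R^d: its iterated partial derivatives, in any
   order, exist and are continuous. *)
Definition smooth (u : R -> 'rV[R]_d -> R) : Prop :=
  forall s : seq (option 'I_d), continuous_with_partials (foldr spacetime_partial u s).

End smooth.

Definition Cm (R : realType) (m : R) : R := 9^-1 * (- 2 * m ^+ 2 + m + 1).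

(* Main.v *)
Require Import Defs.
From HB Require Import structures.
From mathcomp Require Import all_boot all_order all_algebra.
From mathcomp Require Import all_classical all_reals all_analysis.
From mathcomp Require Import ring lra.
Import Order.TTheory GRing.Theory Num.Theory.
Import numFieldNormedType.Exports.
Local Open Scope classical_set_scope.
Local Open Scope ring_scope.
Set Implicit Arguments.
Unset Strict Implicit.
Unset Printing Implicit Defensive.

(* Write u for h at a fixed time.  The evolution equation gives
     1/(m(m+1)) d/dt int u^(m+1) = - 1/m int u^m div(u grad Lap u),
   so it suffices to find a periodic vector field V with
     - 1/m u^m div(u grad Lap u) + C_m u^(m-2) |grad u|^4 <= div V  pointwise.
   Integrating int u^m grad u . grad Lap u by parts yields either
   - int u^m (Lap u)^2 - m int u^(m-1) |grad u|^2 Lap u or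
   - int u^m |Hess u|^2 - m int u^(m-1) Hess u(grad u, grad u); the two forms are
   taken with weights 1/3 and 2/3, and a multiple of div(u^(m-1) |grad u|^2 grad u)
   is added to complete the squares of Lap u and Hess u.

   That div V integrates to 0 comes from the translation invariance of the
   integral over the torus, differentiated under the integral sign. *)

(** * Limits and continuity of sums, products and row vectors *)

Lemma continuous_compose (X Y Z : topologicalType) (f : Y -> Z) (g : X -> Y) :
  continuous f -> continuous g -> continuous (fun x => f (g x)).
Proof. by move=> cf cg x; exact: (cvg_comp _ _ (cg x) (cf (g x))). Qed.

Lemma continuous_addr (R : realType) (X : topologicalType) (f g : X -> R) :
  continuous f -> continuous g -> continuous (fun x => f x + g x).
Proof. by move=> cf cg x; exact: (cvgD (cf x) (cg x)). Qed.

Lemma continuous_mulr (R : realType) (X : topologicalType) (f g : X -> R) :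
  continuous f -> continuous g -> continuous (fun x => f x * g x).
Proof. by move=> cf cg x; exact: (cvgM (cf x) (cg x)). Qed.

Lemma cvg_mx (R : realType) (I : Type) (F : set_system I) {FF : Filter F}
    (k n : nat) (f : I -> 'M[R]_(k, n)) (M : 'M[R]_(k, n)) :
  (forall i j, f x i j @[x --> F] --> M i j) -> f x @[x --> F] --> M.
Proof.
move=> fM B [P MP PB]; apply: (filterS (P := fun x => forall i j, P i j (f x i j))).
  by move=> x Px; apply: PB.
apply: filter_forall => i; apply: filter_forall => j.
exact: (fM i j) (MP i j).
Qed.

Lemma cvg_sumr (R : realType) (I : Type) (F : set_system I) {FF : Filter F}
    (J : Type) (r : seq J) (f : J -> I -> R) (l : J -> R) :
  (forall j, f j x @[x --> F] --> l j) ->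
  \sum_(j <- r) f j x @[x --> F] --> \sum_(j <- r) l j.
Proof.
move=> fl; apply: cvg_big => // x; exact: add_continuous.
Qed.

Lemma continuous_sumr (R : realType) (X : topologicalType) (J : Type)
    (r : seq J) (f : J -> X -> R) :
  (forall j, continuous (f j)) -> continuous (fun x => \sum_(j <- r) f j x).
Proof. by move=> cf x; apply: cvg_sumr => j; exact: cf. Qed.

Lemma cvg_row_mx (R : realType) (I : Type) (F : set_system I) {FF : Filter F}
    (n : nat) (a : I -> R) (s : R) (f : I -> 'rV[R]_n) (v : 'rV[R]_n) :
  a x @[x --> F] --> s -> f x @[x --> F] --> v ->
  row_mx (const_mx (a x) : 'rV[R]_1) (f x) @[x --> F]
    --> row_mx (const_mx s : 'rV[R]_1) v.
Proof.
move=> fs fv; apply: cvg_mx => i j.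
case: (splitP j) => l jl.
  have -> : j = lshift n l by apply/val_inj.
  by under eq_fun do rewrite row_mxEl mxE; rewrite row_mxEl mxE.
have -> : j = rshift 1 l by apply/val_inj.
under eq_fun do rewrite row_mxEr; rewrite row_mxEr.
exact: (cvg_comp _ _ fv (@coord_continuous _ _ _ _ _ v)).
Qed.

Lemma continuous_row_mx (R : realType) (X : topologicalType)
    (n : nat) (a : X -> R) (f : X -> 'rV[R]_n) :
  continuous a -> continuous f ->
  continuous (fun x => row_mx (const_mx (a x) : 'rV[R]_1) (f x)).
Proof. by move=> ca cf x; exact: (cvg_row_mx (ca x) (cf x)). Qed.

(** * Integration over the unit cube *)

Section cube.
Variable R : realType.
Notation mu := (@lebesgue_measure R).

Definition unit_cube (n : nat) : set 'rV[R]_n :=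
  [set y | forall i, `[0, 1]%classic (y 0 i)].

Lemma compact_unit_cube n : compact (@unit_cube n).
Proof.
apply: (@rV_compact R n (fun=> `[0, 1]%classic)) => i; exact: segment_compact.
Qed.

Lemma unit_cube_row_mx n (s : R) (y : 'rV[R]_n) :
  0 <= s <= 1 -> unit_cube y -> unit_cube (row_mx (const_mx s : 'rV[R]_1) y).
Proof.
move=> s01 yc i; case: (splitP i) => l il.
  have -> : i = lshift n l by apply/val_inj.
  by rewrite row_mxEl mxE /= in_itv.
have -> : i = rshift 1 l by apply/val_inj.
by rewrite row_mxEr; exact: yc.
Qed.

Lemma continuous_row_mx_section n (f : 'rV[R]_n.+1 -> R) (s : R) :
  continuous f -> continuous (fun y : 'rV[R]_n => f (row_mx (const_mx s : 'rV[R]_1) y)).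
Proof.
move=> cf; apply: (continuous_compose cf).
by apply: (@continuous_row_mx _ _ _ (fun=> s) id);
  [exact: cst_continuous|move=> y; exact: cvg_id].
Qed.

Lemma integrable01 (f : R -> R) :
  continuous f -> mu.-integrable `[0, 1] (EFin \o f).
Proof.
move=> cf; apply: continuous_compact_integrable; first exact: segment_compact.
exact: continuous_subspaceT.
Qed.

Lemma lebesgue_measure01 : mu `[0, 1] = 1%:E.
Proof. by rewrite lebesgue_measure_itv /= lte_fin ltr01 oppr0 adde0. Qed.

Lemma cube_integral_cst n (c : R) : cube_integral (fun _ : 'rV[R]_n => c) = c.
Proof.
elim: n => //= n IH; rewrite IH Rintegral_cst //.
by rewrite [X in fine X]lebesgue_measure01 mulr1.
Qed.

(** The outer integral can be split or compared only once the inner one is known to be continuous in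
    the outer variable, and that continuity comes from linearity and monotonicity one dimension
    lower. Bundling the two properties lets a single induction carry them. *)
Let linear_monotone n :=
  (forall (f g : 'rV[R]_n -> R) (a : R), continuous f -> continuous g ->
     cube_integral (fun y => f y + a * g y)
     = cube_integral f + a * cube_integral g) /\
  (forall f g : 'rV[R]_n -> R, continuous f -> continuous g ->
     (forall y, unit_cube y -> f y <= g y) ->
     cube_integral f <= cube_integral g).

(** Compactness turns closeness that is local in [y] and eventual in [i] into closeness uniform on
    the cube. The integral of [f i] then lies between those of [g - e] and [g + e], and a constant
    integrates to itself. *)
Let cvg_aux n : linear_monotone n ->
  forall (I : Type) (F : set_system I) {FF : Filter F}
    (f : I -> 'rV[R]_n -> R) (g : 'rV[R]_n -> R),
  (\forall i \near F, continuous (f i)) -> continuous g ->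
  (forall y, unit_cube y -> forall e : R, 0 < e ->
     \forall z \near (nbhs y, F), `|f z.2 z.1 - g z.1| <= e) ->
  cube_integral (f i) @[i --> F] --> cube_integral g.
Proof.
move=> [lin mon] I F FF f g cf cg fg.
apply/cvgrPdist_le => e e0.
have /(compact_near_coveringP _).1 := @compact_unit_cube n.
move=> /(_ _ F (fun i y => `|f i y - g y| <= e) FF) => /(_ (fun y yc => fg y yc e e0)).
move=> He; near=> i.
have ci : continuous (f i) by near: i.
have Hi : forall y, unit_cube y -> `|f i y - g y| <= e by near: i.
have c1 (c : R) : continuous (fun _ : 'rV[R]_n => c) by exact: cst_continuous.
have up : cube_integral (f i) <= cube_integral g + e.
  have -> : cube_integral g + e = cube_integral (fun y => g y + 1 * e).
    by rewrite (lin g (fun=> e) 1)// cube_integral_cst mul1r.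
  apply: mon => //.
    exact: (continuous_addr cg (c1 _)).
  move=> y yc; have := Hi _ yc; rewrite ler_norml mul1r => /andP[_].
  by rewrite lerBlDl.
have dn : cube_integral g - e <= cube_integral (f i).
  have -> : cube_integral g - e = cube_integral (fun y => g y + (- 1) * e).
    by rewrite (lin g (fun=> e) (-1))// cube_integral_cst mulN1r.
  apply: mon => //.
    exact: (continuous_addr cg (c1 _)).
  move=> y yc; have := Hi _ yc; rewrite ler_norml mulN1r => /andP[+ _].
  by rewrite lerBrDl.
by rewrite ler_norml; lra.
Unshelve. all: by end_near. Qed.

Let continuous_aux n : linear_monotone n ->
  forall f : 'rV[R]_n.+1 -> R, continuous f ->
  continuous (fun s => cube_integral (fun y => f (row_mx (const_mx s : 'rV[R]_1) y))).
Proof.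
move=> lm f cf s; apply: cvg_aux => //.
- by near=> i; exact: continuous_row_mx_section.
- exact: continuous_row_mx_section.
move=> y yc e e0; near=> z.
rewrite (le_trans (ler_distD (f (row_mx (const_mx s : 'rV[R]_1) y)) _ _))//.
rewrite [e]splitr lerD//; near: z.
  have : continuous (fun z : 'rV[R]_n * R => f (row_mx (const_mx z.2 : 'rV[R]_1) z.1)).
    apply: (continuous_compose cf).
    by apply: (@continuous_row_mx _ _ _ snd fst) => z; [exact: cvg_snd|exact: cvg_fst].
  by move=> /(_ (y, s)) /cvgrPdistC_le; apply; rewrite divr_gt0.
have : continuous (fun z : 'rV[R]_n * R => f (row_mx (const_mx s : 'rV[R]_1) z.1)).
  apply: (continuous_compose cf).
  by apply: (@continuous_row_mx _ _ _ (fun=> s) fst);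
    [exact: cst_continuous|move=> z; exact: cvg_fst].
by move=> /(_ (y, s)) /cvgrPdist_le; apply; rewrite divr_gt0.
Unshelve. all: by end_near. Qed.

Let linear_monotoneP n : linear_monotone n.
Proof.
elim: n => [|n IH].
  split=> // f g cf cg; apply => i; by case: i.
have [lin mon] := IH; have cts := continuous_aux IH.
split=> [f g a cf cg|f g cf cg fg] /=.
  rewrite -RintegralZl//; last exact/integrable01/cts.
  rewrite -RintegralD//; last 2 first.
  - exact/integrable01/cts.
  - apply: (@integrable01 (fun s => a * _)).
    by apply: continuous_mulr; [exact: cst_continuous|exact: cts].
  by apply: eq_Rintegral => s _; rewrite lin//; exact: continuous_row_mx_section.
apply: le_Rintegral => //; [exact/integrable01/cts|exact/integrable01/cts|].
move=> s /=; rewrite in_itv /= => s01.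
apply: mon; [exact: continuous_row_mx_section|exact: continuous_row_mx_section|].
by move=> y yc; apply: fg; exact: unit_cube_row_mx.
Qed.

Lemma cube_integral_linear n (f g : 'rV[R]_n -> R) (a : R) :
  continuous f -> continuous g ->
  cube_integral (fun y => f y + a * g y) = cube_integral f + a * cube_integral g.
Proof. exact: (linear_monotoneP n).1. Qed.

Lemma le_cube_integral n (f g : 'rV[R]_n -> R) :
  continuous f -> continuous g -> (forall y, unit_cube y -> f y <= g y) ->
  cube_integral f <= cube_integral g.
Proof. exact: (linear_monotoneP n).2. Qed.

Lemma cvg_cube_integral n (I : Type) (F : set_system I) {FF : Filter F}
    (f : I -> 'rV[R]_n -> R) (g : 'rV[R]_n -> R) :
  (\forall i \near F, continuous (f i)) -> continuous g ->
  (forall y, unit_cube y -> forall e : R, 0 < e ->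
     \forall z \near (nbhs y, F), `|f z.2 z.1 - g z.1| <= e) ->
  cube_integral (f i) @[i --> F] --> cube_integral g.
Proof. exact: (cvg_aux (linear_monotoneP n)). Qed.

Lemma continuous_cube_integral n (f : 'rV[R]_n.+1 -> R) : continuous f ->
  continuous (fun s => cube_integral (fun y => f (row_mx (const_mx s : 'rV[R]_1) y))).
Proof. exact: (continuous_aux (linear_monotoneP n)). Qed.

End cube.

(** * Translation invariance of integrals of periodic functions *)

Section periodic_integral.
Variable R : realType.
Notation mu := (@lebesgue_measure R).

(** The primitive is the integral from [c], which is controlled only to the right of [c]; [c] is
    left free so that it can be placed below every point of interest. *)
Lemma exists_primitive (g : R -> R) (c : R) : continuous g ->
  exists F : R -> R, forall x : R, c < x -> is_derive x 1 F (g x).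
Proof.
move=> cg; exists (fun x => \int[mu]_(t in `[c, x]) g t) => x cx.
have ig : mu.-integrable `[c, x + 1] (EFin \o g).
  apply: continuous_compact_integrable; first exact: segment_compact.
  exact: continuous_subspaceT.
have xx1 : x < x + 1 by rewrite ltrDl.
have [dF dE] := continuous_FTC1_closed xx1 ig cx (cg x).
by split; [exact: dF|rewrite -derive1E; exact: dE].
Qed.

Lemma Rintegral01_primitive (g F : R -> R) : continuous g ->
  (forall x : R, 0 <= x <= 1 -> is_derive x 1 F (g x)) ->
  \int[mu]_(x in `[0, 1]) g x = F 1 - F 0.
Proof.
move=> cg dF.
have cF (x : R) : 0 <= x <= 1 -> {for x, continuous F}.
  by move=> /dF [+ _] => /derivable1_diffP; exact: differentiable_continuous.
rewrite /Rintegral (@continuous_FTC2 _ g F 0 1)//.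
- exact: continuous_subspaceT.
- split.
  + by move=> x; rewrite in_itv /= => /andP[x0 x1]; have [] := dF x ltac:(lra).
  + apply: cvg_at_right_filter; apply: cF; rewrite lexx ler01//.
  + apply: cvg_at_left_filter; apply: cF; rewrite lexx ler01//.
- move=> x; rewrite in_itv /= => /andP[x0 x1].
  by rewrite derive1E; have [_ ->] := dF x ltac:(lra).
Qed.

Lemma is_derive_shiftr (F : R -> R) (x a df : R) :
  is_derive (x + a) 1 F df -> is_derive x 1 (fun z => F (z + a)) df.
Proof.
move=> dF; rewrite -[df]mulr1; apply: (@is_derive1_comp _ F (fun z => z + a)) => //.
exact: is_derive_shift.
Qed.

(** For a primitive [F] of [g], periodicity makes the derivative of [F (x + 1) - F x] vanish, so
    this increment takes the same value at [0] and at [a]. *)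
Lemma Rintegral01_shift (g : R -> R) (a : R) : continuous g ->
  (forall x, g (x + 1) = g x) ->
  \int[mu]_(x in `[0, 1]) g (x + a) = \int[mu]_(x in `[0, 1]) g x.
Proof.
move=> cg per.
(* This base point lies strictly to the left of both [[0, 1]] and [[a, a + 1]]. *)
have [F dF] := exists_primitive (Num.min a 0 - 1) cg.
have ma : Num.min a 0 <= a by rewrite ge_min lexx.
have m0 : Num.min a 0 <= 0 by rewrite ge_min lexx orbT.
have -> : \int[mu]_(x in `[0, 1]) g x = F 1 - F 0.
  by apply: Rintegral01_primitive => // x x01; apply: dF; lra.
have -> : \int[mu]_(x in `[0, 1]) g (x + a) = F (a + 1) - F a.
  rewrite -[in F a](add0r a) [in F (a + 1)](addrC a).
  apply: (@Rintegral01_primitive (fun x => g (x + a)) (fun x => F (x + a))).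
    apply: (continuous_compose cg); apply: continuous_addr; last exact: cst_continuous.
    by move=> x; exact: cvg_id.
  by move=> x x01; apply: is_derive_shiftr; apply: dF; lra.
have dK (x : R) : Num.min a 0 - 1 < x -> is_derive x 1 (fun z => F (z + 1) - F z) 0.
  move=> cx; rewrite -[0](subrr (g x)).
  apply: is_deriveB; last exact: dF.
  by rewrite -per; apply: is_derive_shiftr; apply: dF; lra.
have K (x y : R) : Num.min a 0 - 1 < x -> x < y ->
    F (x + 1) - F x = F (y + 1) - F y.
  move=> cx xy; have dK' (z : R) : z \in `]x, y[%R ->
      is_derive z 1 (fun z => F (z + 1) - F z) ((fun=> 0) z).
    by rewrite in_itv /= => /andP[xz _]; apply: dK; lra.
  have [|z _] := MVT xy dK'.
    apply: derivable_within_continuous => z; rewrite in_itv /= => /andP[xz _].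
    by have [] := dK z ltac:(lra).
  by rewrite mul0r => /eqP; rewrite subr_eq0 => /eqP.
have -> : F 1 - F 0 = F (0 + 1) - F 0 by rewrite add0r.
have [a0|a0|->//] := ltgtP a 0.
  by apply: K => //; lra.
by apply/esym; apply: K => //; lra.
Qed.

Lemma row_mx_head n (v : 'rV[R]_(1 + n)) :
  v = row_mx (const_mx (v 0 (lshift n 0)) : 'rV[R]_1) (rsubmx v).
Proof.
rewrite -[LHS]hsubmxK; congr row_mx.
by apply/rowP => i; rewrite !mxE ord1.
Qed.

(** By induction on the dimension: at a fixed head, the induction hypothesis absorbs the tail [w] of
    [v]. What remains is a shift by [a] of the partial integral [G], a continuous function of period
    1 in one variable. *)
Lemma cube_integral_shift n (f : 'rV[R]_n -> R) (v : 'rV[R]_n) : continuous f ->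
  (forall x i, f (x + delta_mx 0 i) = f x) ->
  cube_integral (fun y => f (y + v)) = cube_integral f.
Proof.
elim: n f v => [|n IH] f v cf per /=.
  by rewrite (thinmx0 v) addr0.
pose a := (v : 'rV[R]_(1 + n)) 0 (lshift n 0).
pose w : 'rV[R]_n := @rsubmx _ 1 1 n v.
have vE : v = row_mx (const_mx a : 'rV[R]_1) w := row_mx_head v.
pose G (s : R) := cube_integral (fun y => f (row_mx (const_mx s : 'rV[R]_1) y)).
have GE (s : R) : cube_integral (fun y => f (row_mx (const_mx s : 'rV[R]_1) y + v))
    = G (s + a).
  rewrite /G -[RHS](IH _ w); last 2 first.
  - exact: continuous_row_mx_section.
  - move=> x i.
    have -> : row_mx (const_mx (s + a) : 'rV[R]_1) (x + delta_mx 0 i) =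
        row_mx (const_mx (s + a) : 'rV[R]_1) x + delta_mx 0 (rshift 1 i).
      by rewrite delta_mx_rshift add_row_mx addr0.
    exact: per.
  congr cube_integral; apply/funext => y; congr f.
  have -> : const_mx (s + a) = const_mx s + const_mx a :> 'rV[R]_1.
    by apply/rowP => i; rewrite !mxE.
  by rewrite vE add_row_mx.
rewrite -[RHS](@Rintegral01_shift G a).
- by apply: eq_Rintegral => s _; exact: GE.
- exact: continuous_cube_integral.
- move=> s; congr cube_integral; apply/funext => y.
  have -> : row_mx (const_mx (s + 1) : 'rV[R]_1) y =
      row_mx (const_mx s : 'rV[R]_1) y + delta_mx 0 (lshift n 0).
    rewrite delta_mx_lshift add_row_mx addr0; congr row_mx.
    by apply/rowP => i; rewrite !mxE !ord1 eqxx.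
  exact: per.
Qed.

End periodic_integral.

(** * One-sided time derivatives and differentiation under the integral sign *)

Section time_derivative_facts.
Variables (R : realType) (T : R).
Hypothesis T0 : 0 < T.

(** Properness makes the limit of the difference quotients unique, so that [dt] can be computed from
    any known limit. A short step to the right, or to the left when [t = T], stays in the
    interval. *)
Lemma within_dnbhs_proper (t : R) : 0 <= t <= T -> ProperFilter (within `[0, T] t^').
Proof.
move=> t0T; split; last exact: within_filter.
move=> /nbhs_ballP [e /= e0] H.
have [tT|tT] := ltP t T.
  pose s := t + Num.min (e / 2) (T - t).
  have m1 : Num.min (e / 2) (T - t) <= e / 2 by rewrite ge_min lexx.
  have m2 : Num.min (e / 2) (T - t) <= T - t by rewrite ge_min lexx orbT.
  have m0 : 0 < Num.min (e / 2) (T - t) by rewrite lt_min; apply/andP; split; lra.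
  apply: (H s) => /=; rewrite /s.
  - rewrite /ball /= opprD addrA subrr sub0r normrN gtr0_norm //; lra.
  - by rewrite gt_eqF// ltrDl.
  - rewrite in_itv /=; lra.
pose s := t - Num.min (e / 2) t.
have m1 : Num.min (e / 2) t <= e / 2 by rewrite ge_min lexx.
have m2 : Num.min (e / 2) t <= t by rewrite ge_min lexx orbT.
have m0 : 0 < Num.min (e / 2) t by rewrite lt_min divr_gt0//= (lt_le_trans T0).
apply: (H s) => /=; rewrite /s.
- rewrite /ball /= opprB addrC subrK gtr0_norm //; lra.
- by rewrite lt_eqF// gtrDl oppr_lt0.
- rewrite in_itv /=; lra.
Qed.

Lemma dt_val (g : R -> R) (t l : R) : 0 <= t <= T ->
  dt_quotient T g t --> l -> dt T g t = l.
Proof. by move=> /within_dnbhs_proper tF gl; apply: cvg_lim gl. Qed.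

Lemma dt_continuous (g : R -> R) (t l : R) : dt_quotient T g t --> l ->
  g s @[s --> within `[0, T] (nbhs t)] --> g t.
Proof.
move=> gl; apply/cvgrPdistC_le => e e0.
have /cvgrPdist_le /(_ 1 ltr01) H := gl.
have H' : \forall s \near within `[0, T] (nbhs t),
   s != t -> `|l - (g s - g t) / (s - t)| <= 1.
  exact: (@filterS _ (nbhs t) _ _ _ (fun s Hs sT st => Hs st sT) H).
(* Near [t] the quotient is within 1 of [l], hence bounded by [e / d] in absolute value; for [s]
   within [d] of [t] the increment is then at most [e]. *)
pose d := e / (`|l| + 1).
have d0 : 0 < d by rewrite divr_gt0// ltr_wpDl.
near=> s.
have [->|st] := eqVneq s t; first by rewrite subrr normr0 ltW.
have st0 : s - t != 0 by rewrite subr_eq0.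
have h1 : `|l - (g s - g t) / (s - t)| <= 1.
  by move: st; near: s.
have h2 : `|s - t| <= d.
  near: s; apply: (@cvg_within _ (nbhs t)) => /=.
  by apply/nbhs_ballP; exists d => //= s; rewrite /ball /= distrC => /ltW.
have -> : g s - g t = ((g s - g t) / (s - t)) * (s - t) by rewrite divfK.
rewrite normrM (@le_trans _ _ ((`|l| + 1) * d))//.
  apply: ler_pM => //.
  rewrite -lerBlDl (le_trans (lerB_dist _ _))// distrC//.
by rewrite /d mulrC divfK// gt_eqF// ltr_wpDl.
Unshelve. all: by end_near. Qed.

(** Away from the endpoints, [t + h] stays in [[0, T]] for small [h], so the restriction to the
    interval disappears in the limit. *)
Lemma dt_is_derive (g : R -> R) (t l : R) : 0 < t < T ->
  dt_quotient T g t --> l -> is_derive t 1 g l.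
Proof.
move=> t0T gl.
have H : h^-1 *: ((g \o shift t) (h *: 1) - g t) @[h --> 0^'] --> l.
  have : (h + t) @[h --> (0 : R)^'] --> within `[0, T] t^'.
    move=> P /nbhs_ballP [e /= e0 HP].
    apply/nbhs_ballP; exists (Num.min e (Num.min t (T - t))) => /=.
      by rewrite !lt_min e0 /= ; apply/andP; split; lra.
    move=> h; rewrite /ball /= sub0r normrN !lt_min => /and3P[he ht hT] h0.
    apply: HP => /=.
    - by rewrite /ball /= opprD addrCA subrr addr0 normrN.
    - by rewrite -subr_eq0 addrK.
    - by rewrite in_itv /=; move: ht hT; rewrite !ltr_norml => /andP[? ?] /andP[? ?]; lra.
  move=> /cvg_comp /(_ gl); apply: cvg_trans.
  apply: near_eq_cvg; near=> h => /=.
  by rewrite addrK mulrC /GRing.scale /= mulr1.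
split; first by apply/cvg_ex; exists l.
exact: cvg_lim H.
Unshelve. all: by end_near. Qed.

Lemma dt_MVT (g dg : R -> R) (s t : R) : 0 <= s -> s < t -> t <= T ->
  (forall r, 0 <= r <= T -> dt_quotient T g r --> dg r) ->
  exists2 c, s < c < t & g t - g s = dg c * (t - s).
Proof.
move=> s0 st tT gdg.
have d (r : R) : r \in `]s, t[%R -> is_derive r 1 g (dg r).
  by rewrite in_itv /= => /andP[? ?]; apply: dt_is_derive; [lra|apply: gdg; lra].
have [|c] := MVT st d; last by rewrite in_itv /= => ct E; exists c.
apply/subspace_continuousP => r /=; rewrite in_itv /= => rst.
apply: (@cvg_trans _ (g s @[s --> within `[0, T] (nbhs r)])); last first.
  by apply: (@dt_continuous _ _ (dg r)); apply: gdg; lra.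
apply: cvg_app; apply: within_subset => x /=; rewrite !in_itv /=; lra.
Qed.

(** This form treats both orders of [s] and [t] at once and keeps [c] in every ball around [t] that
    contains [s], so that estimates valid near [t] apply at [c]. *)
Lemma dt_MVT_near (g dg : R -> R) (s t : R) :
  0 <= s <= T -> 0 <= t <= T -> s != t ->
  (forall r, 0 <= r <= T -> dt_quotient T g r --> dg r) ->
  exists c, [/\ 0 <= c <= T, `|c - t| <= `|s - t| & g s - g t = dg c * (s - t)].
Proof.
move=> /andP[s0 sT] /andP[t0 tT]; rewrite neq_lt => /orP[st|ts] gdg.
  have [c /andP[sc ct] E] := dt_MVT s0 st tT gdg.
  exists c; split; first by lra.
    by rewrite !ltr0_norm ?subr_lt0//; lra.
  by rewrite -opprB E; ring.
have [c /andP[tc cs] E] := dt_MVT t0 ts sT gdg.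
exists c; split=> //; first by lra.
by rewrite !gtr0_norm ?subr_gt0//; lra.
Qed.

(** The mean value theorem replaces the difference quotient at [y] by [df c y], with [c] no farther
    from [t] than [s]. Joint continuity of [df] makes this close to [df t y], locally uniformly in
    [y], as [cvg_cube_integral] demands. *)
Lemma cube_integral_dt n (f df : R -> 'rV[R]_n -> R) (t : R) : 0 <= t <= T ->
  (forall s, 0 <= s <= T -> continuous (f s)) -> continuous (df t) ->
  (forall s y, 0 <= s <= T -> dt_quotient T (f ^~ y) s --> df s y) ->
  (forall y, df z.2 z.1 @[z --> (nbhs y, within `[0, T] (nbhs t))] --> df t y) ->
  dt_quotient T (fun s => cube_integral (f s)) t --> cube_integral (df t).
Proof.
move=> tT cf cdf fdf cdf2.
apply: (@cvg_trans _ (cube_integral (fun y => (s - t)^-1 * f s y + (- (s - t)^-1) * f t y)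
    @[s --> within `[0, T] t^'])).
  apply: near_eq_cvg; near=> s.
  have s0T : 0 <= s <= T.
    suff : `[0, T]%classic s by rewrite /= in_itv.
    by near: s; exact: withinT.
  rewrite cube_integral_linear; last 2 first.
  - apply: continuous_mulr; [exact: cst_continuous|exact: cf].
  - exact: cf.
  (* Scalar multiples are the case of linearity where the first summand is zero. *)
  have := @cube_integral_linear _ n (fun=> 0) (f s) (s - t)^-1.
  rewrite cube_integral_cst add0r => /(_ (@cst_continuous _ _ _) (cf _ s0T)) E.
  rewrite (_ : cube_integral (fun y => _) = cube_integral (fun y => 0 + (s - t)^-1 * f s y)).
    by rewrite E; ring.
  by congr cube_integral; apply/funext => y; rewrite add0r.
apply: cvg_cube_integral => //.
  near=> s; have s0T : 0 <= s <= T.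
    suff : `[0, T]%classic s by rewrite /= in_itv.
    by near: s; exact: withinT.
  by apply: continuous_addr; apply: continuous_mulr;
    [exact: cst_continuous|exact: cf|exact: cst_continuous|exact: cf].
move=> y yc e e0.
have e20 : 0 < e / 2 by rewrite divr_gt0.
have /cvgrPdistC_le/(_ _ e20) := cdf2 y.
case=> -[/= U V] [/= yU /nbhs_ballP [/= r r0 rV]] UV.
have /cvgrPdist_le/(_ _ e20) yW := cdf y.
have HP : \forall s \near within `[0, T] t^', [/\ 0 <= s <= T, s != t & ball t r s].
  by apply/nbhs_ballP; exists r.
near=> z.
have zU : U z.1 by near: z; exact: cvg_fst.
have zW : `|df t y - df t z.1| <= e / 2 by near: z; exact: (cvg_fst yW).
have zs : [/\ 0 <= z.2 <= T, z.2 != t & ball t r z.2].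
  by near: z; exact: (@cvg_snd _ _ (nbhs y) (within `[0, T] t^') _ _ HP).
case: zs => s0T st bs.
have [c [c0T ct E]] := dt_MVT_near s0T tT st (fun s => @fdf s z.1).
have bc : ball t r c.
  by move: bs; rewrite /ball /= -![`|t - _|]distrC; exact: le_lt_trans.
have -> : (z.2 - t)^-1 * f z.2 z.1 + - (z.2 - t)^-1 * f t z.1 = df c z.1.
  rewrite mulNr -mulrBr E mulrCA mulVf ?mulr1//.
  by rewrite subr_eq0.
have := UV (z.1, c) (conj zU (rV c bc _)); rewrite /= in_itv /= => /(_ c0T) h1.
by rewrite (le_trans (ler_distD (df t y) _ _))// [e]splitr lerD.
Unshelve. all: by end_near. Qed.

End time_derivative_facts.

(** * Directional derivatives *)

Section directional.
Variables (R : realType) (V : normedModType R).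
Implicit Types (f : V -> R) (x u v : V).

(** The two difference quotients are the same expression. This transfers one-variable results, such
    as the mean value theorem and the chain rule, to directional derivatives. *)
Lemma is_derive_line f x v (a l : R) :
  is_derive a 1 (fun r : R => f (x + r *: v)) l <-> is_derive (x + a *: v) v f l.
Proof.
have E : (fun h : R => h^-1 *: (((fun r : R => f (x + r *: v)) \o shift a) (h *: 1)
      - f (x + a *: v)))
    = (fun h : R => h^-1 *: ((f \o shift (x + a *: v)) (h *: v) - f (x + a *: v))).
  apply/funext => h /=; congr (_ *: (f _ - _)).
  have -> : h *: (1 : R) = h by exact: mulr1.
  by rewrite scalerDl addrCA.
split=> -[dl vl]; split.
- by move: dl; rewrite /derivable E.
- by rewrite -vl /derive E.
- by move: dl; rewrite /derivable E.
- by rewrite -vl /derive E.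
Qed.

Lemma is_derive_comp1 (p : R -> R) f x v (a l : R) :
  is_derive (f x) 1 p a -> is_derive x v f l ->
  is_derive x v (fun y => p (f y)) (a * l).
Proof.
have xE : x = x + 0 *: v by rewrite scale0r addr0.
move=> dp df; rewrite [x]xE; apply/(@is_derive_line (fun y => p (f y))).
apply: (@is_derive1_comp _ p (fun r => f (x + r *: v))).
  by rewrite -xE.
by apply/is_derive_line; rewrite -xE.
Qed.

Lemma dt_quotient_line (T : R) f x v (s l : R) :
  is_derive (x + s *: v) v f l -> dt_quotient T (fun r => f (x + r *: v)) s --> l.
Proof.
move=> [dl vl].
have {dl vl} : h^-1 *: ((f \o shift (x + s *: v)) (h *: v) - f (x + s *: v))
    @[h --> 0^'] --> l.
  by rewrite -vl; exact: dl.
have : (r - s) @[r --> within `[0, T] s^'] --> (0 : R)^'.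
  apply: (@cvg_trans _ ((r - s) @[r --> s^'])).
    by apply: cvg_app; exact: cvg_within.
  move=> P /nbhs_ballP [e /= e0 HP]; apply/nbhs_ballP; exists e => //= r.
  rewrite /ball /= => rs rs0; apply: HP => /=; last by rewrite subr_eq0.
  by rewrite /ball /= sub0r opprB.
move=> /cvg_comp H /H; apply: cvg_trans; apply: near_eq_cvg; near=> r => /=.
rewrite mulrC; congr (_ * (f _ - _)).
by rewrite scalerBl addrCA subrK.
Unshelve. all: by end_near. Qed.

(** The second difference is the increment over [[0, s]] of [f (x + s v + r u) - f (x + r u)] in
    [r]. The mean value theorem in the direction [u] gives [a], and then in the direction [v] gives
    [b]. *)
Lemma second_difference f (fu fvu : V -> R) x u v (s : R) : 0 < s ->
  (forall y, is_derive y u f (fu y)) -> (forall y, is_derive y v fu (fvu y)) ->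
  exists a b, [/\ 0 < a < s, 0 < b < s &
    f (x + s *: u + s *: v) - f (x + s *: u) - (f (x + s *: v) - f x)
      = fvu (x + a *: u + b *: v) * s * s].
Proof.
move=> s0 dfu dfvu.
have d1 (a : R) : is_derive a 1 (fun r : R => f (x + s *: v + r *: u) - f (x + r *: u))
    (fu (x + s *: v + a *: u) - fu (x + a *: u)).
  by apply: is_deriveB; apply/is_derive_line.
have [|a] := MVT s0 (fun a _ => d1 a).
  by apply: derivable_within_continuous => a _; have [] := d1 a.
rewrite in_itv /= => as0 E1.
have d2 (b : R) : is_derive b 1 (fun r : R => fu (x + a *: u + r *: v))
    (fvu (x + a *: u + b *: v)).
  by apply/is_derive_line.
have [|b] := MVT s0 (fun b _ => d2 b).
  by apply: derivable_within_continuous => b _; have [] := d2 b.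
rewrite in_itv /= => bs0 E2; exists a, b; split=> //.
move: E1 E2; rewrite !scale0r !addr0 !subr0 => E1 E2.
rewrite -E2 -[x + a *: u + s *: v]addrA [a *: u + s *: v]addrC addrA -E1.
by rewrite -[x + s *: v + s *: u]addrA [s *: v + s *: u]addrC addrA; ring.
Qed.

(** Schwarz's theorem: the second difference is symmetric in [u] and [v], so division by [s^2]
    equates a value of [fuv] with a value of [fvu], at points that tend to [x] with [s]. *)
Lemma derive_commute f (fu fv fuv fvu : V -> R) x u v :
  (forall y, is_derive y u f (fu y)) -> (forall y, is_derive y v f (fv y)) ->
  (forall y, is_derive y u fv (fuv y)) -> (forall y, is_derive y v fu (fvu y)) ->
  continuous fuv -> continuous fvu -> fuv x = fvu x.
Proof.
move=> dfu dfv dfuv dfvu cuv cvu.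
apply/eqP; rewrite -subr_eq0 -normr_le0; apply/ler_addgt0Pl => e e0.
have e20 : 0 < e / 2 by rewrite divr_gt0.
have lim0 (w w' : V) (g : V -> R) : continuous g -> exists2 r : R, 0 < r &
    forall a b : R, 0 < a < r -> 0 < b < r -> `|g (x + a *: w + b *: w') - g x| <= e / 2.
  move=> cg.
  have c : continuous (fun z : R * R => g (x + z.1 *: w + z.2 *: w')).
    apply: (continuous_compose cg) => z.
    apply: cvgD; last by apply: cvgZr_tmp; exact: cvg_snd.
    by apply: cvgD; [exact: cvg_cst|apply: cvgZr_tmp; exact: cvg_fst].
  have := c (0, 0); rewrite /continuous_at /= !scale0r !addr0.
  move=> /cvgrPdistC_le /(_ _ e20) [[P Q] /= [/nbhs_ballP[r r0 rP] /nbhs_ballP[q q0 qQ]] H].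
  exists (Num.min r q); first by rewrite lt_min r0.
  move=> a b; rewrite !lt_min => /and3P[a0 ar _] /and3P[b0 _ bq].
  apply: (H (a, b)); split => /=.
    by apply: rP; rewrite /ball /= sub0r normrN gtr0_norm.
  by apply: qQ; rewrite /ball /= sub0r normrN gtr0_norm.
have [r r0 Hr] := lim0 v u fuv cuv; have [q q0 Hq] := lim0 u v fvu cvu.
pose s := Num.min r q.
have s0 : 0 < s by rewrite lt_min r0.
have sr : s <= r by rewrite ge_min lexx.
have sq : s <= q by rewrite ge_min lexx orbT.
have [a [b [as0 bs0 E1]]] := second_difference x s0 dfu dfvu.
have [a' [b' [as1 bs1 E2]]] := second_difference x s0 dfv dfuv.
have E : fuv (x + a' *: v + b' *: u) = fvu (x + a *: u + b *: v).
  have sn0 : s != 0 by rewrite gt_eqF.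
  apply: (mulIf sn0); apply: (mulIf sn0).
  rewrite -E1 -E2 -[x + s *: v + s *: u]addrA [s *: v + s *: u]addrC addrA; ring.
have h1 := Hr a' b' ltac:(lra) ltac:(lra).
have h2 := Hq a b ltac:(lra) ltac:(lra).
rewrite addr0; move: h1 h2; rewrite E !ler_norml => /andP[? ?] /andP[? ?].
by apply/andP; split; lra.
Qed.

End directional.

(** * Calculus on the torus *)

Section torus.
Variables (R : realType) (d : nat) (A : 'M[R]_d).
Hypothesis hA : A \in unitmx.
Implicit Types (f g : 'rV[R]_d -> R) (df dg : 'I_d -> 'rV[R]_d -> R).

Lemma continuous_mulmxr : continuous (fun y : 'rV[R]_d => y *m A).
Proof. 
move=> y; apply: (@cvg_mx _ _ (nbhs y) _ _ _ (fun y => y *m A)) => i j.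
under eq_fun do rewrite mxE; rewrite mxE.
by apply: cvg_sumr => l; apply: cvgMl; exact: coord_continuous.
 Qed.

Lemma le_torus_integral f g : continuous f -> continuous g ->
  (forall x, f x <= g x) -> torus_integral A f <= torus_integral A g.
Proof.
move=> cf cg fg; apply: ler_wpM2l => //.
by apply: le_cube_integral => //; apply: continuous_compose => //; exact: continuous_mulmxr.
Qed.

Lemma torus_integral_linear f g (a : R) : continuous f -> continuous g ->
  torus_integral A (fun x => f x + a * g x)
  = torus_integral A f + a * torus_integral A g.
Proof.
move=> cf cg; rewrite /torus_integral cube_integral_linear; first by ring.
- by apply: (continuous_compose cf); exact: continuous_mulmxr.
- by apply: (continuous_compose cg); exact: continuous_mulmxr.
Qed.

Lemma torus_integral_cst (c : R) : torus_integral A (fun=> c) = `|\det A| * c.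
Proof. by rewrite /torus_integral cube_integral_cst. Qed.

Lemma torus_integralZ f (a : R) : continuous f ->
  torus_integral A (fun x => a * f x) = a * torus_integral A f.
Proof.
move=> cf; rewrite -[RHS]add0r -[X in X + _](mulr0 `|\det A|) -torus_integral_cst.
rewrite -torus_integral_linear//; last exact: cst_continuous.
by congr torus_integral; apply/funext => x; rewrite add0r.
Qed.

Lemma torus_integral_sum (J : Type) (r : seq J) (f : J -> 'rV[R]_d -> R) :
  (forall j, continuous (f j)) ->
  torus_integral A (fun x => \sum_(j <- r) f j x)
  = \sum_(j <- r) torus_integral A (f j).
Proof.
move=> cf; elim: r => [|j r IH].
  rewrite big_nil (_ : (fun x => _) = fun=> 0); last first.
    by apply/funext => x; rewrite big_nil.
  by rewrite torus_integral_cst mulr0.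
rewrite big_cons -IH.
rewrite (_ : (fun x => _) = fun x => f j x + 1 * \sum_(j <- r) f j x).
  rewrite torus_integral_linear ?mul1r//; exact: continuous_sumr.
by apply/funext => x; rewrite big_cons mul1r.
Qed.

Lemma torus_integral_dt (T : R) (f df : R -> 'rV[R]_d -> R) (t : R) :
  0 <= t <= T ->
  (forall s, 0 <= s <= T -> continuous (f s)) -> continuous (df t) ->
  (forall s x, 0 <= s <= T -> dt_quotient T (f ^~ x) s --> df s x) ->
  (forall x, df z.2 z.1 @[z --> (nbhs x, within `[0, T] (nbhs t))] --> df t x) ->
  dt_quotient T (fun s => torus_integral A (f s)) t --> torus_integral A (df t).
Proof.
move=> tT cf cdf fdf cdf2.
apply: (@cvg_trans _ (`|\det A| * ((cube_integral (fun y => f s (y *m A))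
    - cube_integral (fun y => f t (y *m A))) / (s - t)) @[s --> within `[0, T] t^'])).
  apply: near_eq_cvg; near=> s; rewrite /torus_integral; ring.
apply: cvgMr.
apply: (@cube_integral_dt _ T _ (fun s y => f s (y *m A)) (fun s y => df s (y *m A))) => //.
- by move=> s sT; apply: (continuous_compose (cf _ sT)); exact: continuous_mulmxr.
- by apply: (continuous_compose cdf); exact: continuous_mulmxr.
- by move=> s y; exact: fdf.
- move=> y.
  have H : (z.1 *m A, z.2) @[z --> (nbhs y, within `[0, T] (nbhs t))] -->
      (nbhs (y *m A), within `[0, T] (nbhs t)).
    move=> P [[U V] /= [yU tV] UV]; exists ((mulmxr A) @^-1` U, V).
      by split=> //=; exact: (@continuous_mulmxr y).
    by move=> [z1 z2] /= [zU zV]; apply: UV.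
  exact: (cvg_comp _ _ H (cdf2 _)).
Unshelve. all: by end_near. Qed.

Lemma cvg_within_pair (D : set R) (k : 'rV[R]_d * R -> R) (x : 'rV[R]_d) (t : R) :
  continuous k -> k z @[z --> (nbhs x, within D (nbhs t))] --> k (x, t).
Proof.
move=> ck; apply: (@cvg_comp _ _ _ (fun z => z) k _ (nbhs (x, t))); last exact: ck.
move=> P [[U V] /= [xU tV] UV]; exists (U, V) => //=; split=> //.
exact: cvg_within.
Qed.

(** The partial derivatives are explicit data, so that the rules below compute the derivatives of a
    composite expression together with the proof of its regularity. *)
Record periodic_C1 f df : Prop := PeriodicC1 {
  periodic_C1_periodic : lattice_periodic A f;
  periodic_C1_continuous : continuous f;
  periodic_C1_continuous_partial : forall i, continuous (df i);
  periodic_C1_is_derive : forall i x, is_derive x (delta_mx 0 i) f (df i x) }.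

(* Differentiate the constant function [s |-> torus_integral A (fun x => f (x + s e_i))]
   under the integral sign. *)
Lemma torus_integral_partial f df i :
  periodic_C1 f df -> torus_integral A (df i) = 0.
Proof.
move=> [pf cf cdf ddf].
pose e : 'rV[R]_d := delta_mx 0 i.
have ce (k : 'rV[R]_d -> R) : continuous k ->
    continuous (fun z : 'rV[R]_d * R => k (z.1 + z.2 *: e)).
  move=> ck; apply: (continuous_compose ck) => z.
  by apply: cvgD; [exact: cvg_fst|apply: cvgZr_tmp; exact: cvg_snd].
have ces (s : R) (k : 'rV[R]_d -> R) :
    continuous k -> continuous (fun x : 'rV[R]_d => k (x + s *: e)).
  move=> ck; apply: (continuous_compose ck) => x.
  exact: (@continuousD _ _ _ id (cst (s *: e)) x cvg_id (@cst_continuous _ _ _ x)).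
(* The length of the translation plays the role of time, on [[0, 1]], and the derivative is taken at
   [0]. *)
have t01 : 0 <= (0 : R) <= 1 by lra.
have dq (s : R) (x : 'rV[R]_d) : 0 <= s <= 1 ->
    dt_quotient 1 (fun r => f (x + r *: e)) s --> df i (x + s *: e).
  by move=> _; apply: dt_quotient_line; exact: ddf.
have H := @torus_integral_dt 1 (fun s x => f (x + s *: e)) (fun s x => df i (x + s *: e)) 0
  t01 (fun s _ => ces s f cf) (ces 0 (df i) (cdf i)) dq
  (fun x => @cvg_within_pair `[0, 1]%classic _ x 0 (ce _ (cdf i))).
have -> : torus_integral A (df i) = torus_integral A (fun x => df i (x + 0 *: e)).
  by congr torus_integral; apply/funext => x; rewrite scale0r addr0.
rewrite -(dt_val ltr01 t01 H); apply: dt_val => //.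
(* In lattice coordinates the translation by [e] is a translation by [v], and lattice periodicity is
   period 1 in each coordinate; this is the setting of [cube_integral_shift]. *)
pose v := e *m invmx A.
have vA : v *m A = e by rewrite mulmxKV.
have C (s : R) : torus_integral A (fun x => f (x + s *: e)) = torus_integral A f.
  rewrite /torus_integral; congr (_ * _).
  rewrite -[RHS](@cube_integral_shift _ _ (fun y => f (y *m A)) (s *: v)).
  - congr cube_integral; apply/funext => y.
    by rewrite mulmxDl -scalemxAl vA.
  - by apply: (continuous_compose cf); exact: continuous_mulmxr.
  - by move=> y j; rewrite mulmxDl -rowE pf.
rewrite /dt_quotient; under eq_fun do rewrite !C subrr mul0r.
exact: cvg_cst.
Qed.

Lemma periodic_C1_add f df g dg : periodic_C1 f df -> periodic_C1 g dg ->
  periodic_C1 (fun x => f x + g x) (fun i x => df i x + dg i x).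
Proof.
move=> [pf cf cdf ddf] [pg cg cdg ddg]; split.
- by move=> x i; rewrite pf pg.
- exact: continuous_addr.
- by move=> i; exact: continuous_addr.
- by move=> i x; apply: is_deriveD.
Qed.

Lemma periodic_C1_mul f df g dg : periodic_C1 f df -> periodic_C1 g dg ->
  periodic_C1 (fun x => f x * g x) (fun i x => df i x * g x + f x * dg i x).
Proof.
move=> [pf cf cdf ddf] [pg cg cdg ddg]; split.
- by move=> x i; rewrite pf pg.
- exact: continuous_mulr.
- by move=> i; apply: continuous_addr; exact: continuous_mulr.
- move=> i x; have dfx := ddf i x; have dgx := ddg i x.
  have -> : df i x * g x + f x * dg i x = f x *: dg i x + g x *: df i x.
    by rewrite /GRing.scale /=; ring.
  exact: is_deriveM.
Qed.

Lemma periodic_C1_cst (c : R) : periodic_C1 (fun=> c) (fun _ _ => 0).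
Proof.
split=> //.
- exact: cst_continuous.
- by move=> i; exact: cst_continuous.
- by move=> i x; exact: is_derive_cst.
Qed.

Lemma periodic_C1_sum (f : 'I_d -> 'rV[R]_d -> R) (df : 'I_d -> 'I_d -> 'rV[R]_d -> R) :
  (forall j, periodic_C1 (f j) (df j)) ->
  periodic_C1 (fun x => \sum_j f j x) (fun i x => \sum_j df j i x).
Proof.
move=> H; split.
- by move=> x i; apply: eq_bigr => j _; have [->] := H j.
- by apply: continuous_sumr => j; have [] := H j.
- by move=> i; apply: continuous_sumr => j; have [] := H j.
- move=> i x; have -> : (fun x => \sum_j f j x) = \sum_j f j.
    by apply/funext => y; rewrite fct_sumE.
  by apply: is_derive_sum => j; have [] := H j.
Qed.

Lemma periodic_C1_powR f df (a : R) : (forall x, 0 < f x) -> periodic_C1 f df ->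
  periodic_C1 (fun x => f x `^ a) (fun i x => a * f x `^ (a - 1) * df i x).
Proof.
move=> f0 [pf cf cdf ddf].
have cp (b : R) : continuous (fun x => f x `^ b).
  move=> x; apply: (@continuous_comp _ _ _ f (fun r => r `^ b) x (cf x)).
  apply: differentiable_continuous; apply/derivable1_diffP.
  by have [] := is_derive1_powR b (f0 x).
split=> //.
- by move=> x i; rewrite pf.
- move=> i; apply: continuous_mulr => //; apply: continuous_mulr => //.
  exact: cst_continuous.
- move=> i x; have dfx := ddf i x; have dp := is_derive1_powR a (f0 x).
  exact: (@is_derive_comp1 _ _ (fun r => r `^ a) f x (delta_mx 0 i) _ (df i x)).
Qed.

Lemma lattice_periodic_partial f i :
  lattice_periodic A f -> lattice_periodic A (partial i f).
Proof.
move=> pf x j; rewrite /partial /derive.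
have -> : (fun h : R =>
      h^-1 *: ((f \o shift (x + row j A)) (h *: delta_mx 0 i) - f (x + row j A)))
    = (fun h : R => h^-1 *: ((f \o shift x) (h *: delta_mx 0 i) - f x)).
  by apply/funext => h /=; rewrite addrA !pf.
by [].
Qed.

End torus.

(** * The dissipation inequality *)

Lemma euclidean_norm4 (R : realType) (d : nat) (v : 'rV[R]_d) :
  euclidean_norm v ^+ 4 = (\sum_i v 0 i * v 0 i) ^+ 2.
Proof.
rewrite /euclidean_norm (exprM _ 2 2) sqr_sqrtr.
  by congr (_ ^+ 2); apply: eq_bigr => i _; rewrite expr2.
by apply: sumr_ge0 => i _; exact: sqr_ge0.
Qed.

Lemma powR_pred (R : realType) (x a : R) : 0 < x -> x `^ (a - 1) = x `^ a / x.
Proof.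
move=> x0; rewrite powRB; first by rewrite powRr1// ltW.
by rewrite (gt_eqF x0) implybT.
Qed.

(** The expression is the squared Frobenius norm of [H + l g (x) g]. *)
Lemma hessian_square_ge0 (R : realType) (n : nat) (H : 'I_n -> 'I_n -> R)
    (g : 'I_n -> R) (l : R) :
  0 <= \sum_i \sum_j H i j * H i j + 2 * l * (\sum_i g i * \sum_j g j * H i j)
    + l ^+ 2 * (\sum_i g i * g i) ^+ 2.
Proof.
have -> : \sum_i \sum_j H i j * H i j + 2 * l * (\sum_i g i * \sum_j g j * H i j)
    + l ^+ 2 * (\sum_i g i * g i) ^+ 2
    = \sum_i \sum_j (H i j + l * g i * g j) ^+ 2.
  rewrite [(\sum_i _) ^+ 2]expr2 mulr_suml !mulr_sumr -!big_split /=; apply: eq_bigr => i _.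
  rewrite !mulr_sumr -!big_split /=; apply: eq_bigr => j _; ring.
by apply: sumr_ge0 => i _; apply: sumr_ge0 => j _; exact: sqr_ge0.
Qed.

(* The right-hand side is the expanded divergence, at a point where [u = p] and
   [u `^ m = w], of the field
     V_i = u^m (- m^-1 u d_i(Lap u) + 1/3 (Lap u) d_i u + 2/3 (Hess u grad u)_i)
           - (2 + m)/9 u^(m-1) |grad u|^2 d_i u;
   its excess over the left-hand side is
     1/3 w (Lap u + l |grad u|^2)^2 + 2/3 w |Hess u + l grad u (x) grad u|^2
   with [l = (m - 1) / (3 p)].  The weights 1/3 and 2/3 are those that
   give the largest constant.  The terms [0 * _] are derivatives of constants: the
   sum has the exact shape produced by the Leibniz rule. *)
Lemma pointwise_dissipation (R : realType) (n : nat) (m p w w1 w2 : R)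
    (g T DT : 'I_n -> R) (H K : 'I_n -> 'I_n -> R) (L G : R) :
  m != 0 -> 0 < p -> 0 < w -> w1 = w / p -> w2 = w1 / p ->
  L = \sum_j H j j -> G = \sum_j g j * g j -> (forall j, \sum_i K i j = T j) ->
  - m^-1 * (w * \sum_i (g i * T i + p * DT i)) + Cm m * (w2 * G ^+ 2) <=
  \sum_i (m * w1 * g i * (- m^-1 * (p * T i) + (1 / 3 * (L * g i) +
        2 / 3 * \sum_j g j * H i j))
     + w * (0 * (p * T i) + - m^-1 * (g i * T i + p * DT i) +
        (0 * (L * g i) + 1 / 3 * (T i * g i + L * H i i) +
        (0 * (\sum_j g j * H i j)
         + 2 / 3 * \sum_j (H i j * H i j + g j * K i j))))
     + (0 * (w1 * (G * g i)) + - (2 + m) / 9 * ((m - 1) * w2 * g i * (G * g i) +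
        w1 * ((\sum_j (H i j * g j + g j * H i j)) * g i + G * H i i)))).
Proof.
move=> m0 p0 w0 -> -> LE GE KT.
pose S i := \sum_j g j * H i j.
pose HH i := \sum_j H i j * H i j.
pose DH i := \sum_j g j * K i j.
(* With a general [k], completing the squares requires [l = (m + 3 k) / (2 p)] and leaves the
   constant [k (m - 1) - (m + 3 k)^2 / 4]. The present value of [k] maximises it, and the maximum is
   [Cm m]. *)
pose k := - (2 + m) / 9.
rewrite [leRHS](eq_bigr (fun i =>
    - m^-1 * w * (g i * T i + p * DT i) + - (2 / 3) * w * (g i * T i)
    + (1 / 3 * m * (w / p) * L + k * (m - 1) * (w / p / p) * G) * (g i * g i)
    + (1 / 3 * w * L + k * (w / p) * G) * H i i
    + (2 / 3 * m * (w / p) + k * 2 * (w / p)) * (g i * S i)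
    + 2 / 3 * w * HH i + 2 / 3 * w * DH i)); last first.
  move=> i _; rewrite big_split /= -/(S i) -/(HH i) -/(DH i).
  have -> : \sum_j (H i j * g j + g j * H i j) = 2 * S i.
    by rewrite mulr_sumr; apply: eq_bigr => j _; ring.
  move: (g i) (H i i) (S i) (HH i) (DH i) (T i) (DT i) => gi Hii Si HHi DHi Ti Di.
  by rewrite /k; field; rewrite m0 gt_eqF.
(* Since the divergence of the Hessian is [T], this third-order term cancels the one with
   coefficient [- (2 / 3) * w] above. *)
have sDH : \sum_i DH i = \sum_i g i * T i.
  rewrite exchange_big /=; apply: eq_bigr => j _.
  by rewrite -mulr_sumr KT.
rewrite !big_split /= -!mulr_sumr big_split /= -!mulr_sumr sDH -LE -GE.
pose l := (m - 1) / 3 / p.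
have := hessian_square_ge0 H g l; rewrite -GE.
rewrite -[\sum_i \sum_j H i j * H i j]/(\sum_i HH i).
rewrite -[\sum_i g i * \sum_j g j * H i j]/(\sum_i g i * S i).
move: (\sum_i g i * S i) (\sum_i HH i) (\sum_i g i * T i) (\sum_i DT i).
move=> Q N GT X sq; rewrite -subr_ge0.
rewrite [leRHS](_ : _ = 1 / 3 * w * (L + l * G) ^+ 2
    + 2 / 3 * w * (N + 2 * l * Q + l ^+ 2 * G ^+ 2)).
  by apply: addr_ge0; apply: mulr_ge0 => //; [lra|exact: sqr_ge0|lra].
by rewrite /l /k /Cm; field; rewrite m0 gt_eqF.
Qed.

Section dissipation.
Variables (R : realType) (d : nat) (A : 'M[R]_d).
Hypothesis hA : A \in unitmx.
(* [D s] is the iterated partial derivative of [u = D [::]] along [s]. *)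
Variables (m : R) (D : seq 'I_d -> 'rV[R]_d -> R).
Local Notation u := (D [::]).
Hypothesis m0 : m != 0.
Hypothesis u0 : forall x, 0 < u x.
Hypothesis CD : forall s, periodic_C1 A (D s) (fun i => D (i :: s)).

Let L x := \sum_j D [:: j; j] x.
Let dL i x := \sum_j D [:: i; j; j] x.
Let ddL l i x := \sum_j D [:: l; i; j; j] x.

Let CL : periodic_C1 A L dL.
Proof.
exact: (@periodic_C1_sum _ _ A (fun j => D [:: j; j])
  (fun j i => D [:: i; j; j]) (fun j => CD _)).
Qed.

Let CdL i : periodic_C1 A (dL i) (fun l => ddL l i).
Proof.
exact: (@periodic_C1_sum _ _ A (fun j => D [:: i; j; j])
  (fun j l => D [:: l; i; j; j]) (fun j => CD _)).
Qed.

Let partialD i s : partial i (D s) = D (i :: s).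
Proof. by apply/funext => x; have [_ _ _ /(_ i x) [_]] := CD s. Qed.

Let laplacianE : laplacian u = L.
Proof.
apply/funext => x; apply: eq_bigr => i _.
rewrite (_ : (fun y => _) = D [:: i]) ?partialD//.
by apply/funext => y; rewrite mxE partialD.
Qed.

Let norm_gradE x : euclidean_norm (grad u x) ^+ 4 = (\sum_i D [:: i] x * D [:: i] x) ^+ 2.
Proof.
by rewrite euclidean_norm4; congr (_ ^+ 2); apply: eq_bigr => i _; rewrite mxE partialD.
Qed.

Let divE x : div (fun y => u y *: grad (laplacian u) y) x
  = \sum_i (D [:: i] x * dL i x + u x * ddL i i x).
Proof.
rewrite laplacianE; apply: eq_bigr => i _.
rewrite (_ : (fun y => _) = fun y => u y * dL i y); last first.
  apply/funext => y; rewrite !mxE; congr (_ * _).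
  by have [_ _ _ /(_ i y) [_]] := CL.
by have [_ _ _ /(_ i x) [_]] := periodic_C1_mul (CD [::]) (CdL i).
Qed.

(* Symmetry of second derivatives turns the divergence of the Hessian into the
   gradient of the Laplacian. *)
Let div_hessianE j x : \sum_i D [:: i; i; j] x = dL j x.
Proof.
have comm s (k l : 'I_d) y : D [:: k, l & s] y = D [:: l, k & s] y.
  apply: (@derive_commute _ _ (D s) (D (k :: s)) (D (l :: s)) _ _ y
    (delta_mx 0 k) (delta_mx 0 l)).
  - by move=> z; have [] := CD s.
  - by move=> z; have [] := CD s.
  - by move=> z; have [] := CD (l :: s).
  - by move=> z; have [] := CD (k :: s).
  - by have [_ _ + _] := CD (l :: s); apply.
  - by have [_ _ + _] := CD (k :: s); apply.
apply: eq_bigr => i _; rewrite -(comm [:: i] i j).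
have E : D [:: i; j] = D [:: j; i] by apply/funext => y; exact: (comm [::]).
by rewrite -(partialD i [:: i; j]) E partialD.
Qed.

Let k : R := - (2 + m) / 9.

(** Regularity of the component [V_i] of the vector field. The tree of rules fixes the unsimplified
    form of its derivatives, which [pointwise_dissipation] reproduces. *)
Let CV i := periodic_C1_add
  (periodic_C1_mul (periodic_C1_powR m u0 (CD [::]))
    (periodic_C1_add
      (periodic_C1_mul (periodic_C1_cst A (- m^-1)) (periodic_C1_mul (CD [::]) (CdL i)))
      (periodic_C1_add
        (periodic_C1_mul (periodic_C1_cst A (1 / 3)) (periodic_C1_mul CL (CD [:: i])))
        (periodic_C1_mul (periodic_C1_cst A (2 / 3))
          (periodic_C1_sum (fun j => periodic_C1_mul (CD [:: j]) (CD [:: i; j])))))))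
  (periodic_C1_mul (periodic_C1_cst A k)
    (periodic_C1_mul (periodic_C1_powR (m - 1) u0 (CD [::]))
      (periodic_C1_mul (periodic_C1_sum (fun j => periodic_C1_mul (CD [:: j]) (CD [:: j])))
         (CD [:: i])))).

Let density1 x := u x `^ m * div (fun y => u y *: grad (laplacian u) y) x.
Let density2 x := u x `^ (m - 2) * euclidean_norm (grad u x) ^+ 4.

Let continuousD s : continuous (D s).
Proof. by have [] := CD s. Qed.

Let continuous_powR (a : R) : continuous (fun x => u x `^ a).
Proof. by have [] := periodic_C1_powR a u0 (CD [::]). Qed.

Lemma continuous_production :
  continuous (fun x => u x `^ m * div (fun y => u y *: grad (laplacian u) y) x).
Proof.
rewrite (_ : (fun x => _) = fun x => u x `^ m *
    \sum_i (D [:: i] x * dL i x + u x * ddL i i x)); last first.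
  by apply/funext => x; rewrite divE.
apply: continuous_mulr => //; apply: continuous_sumr => i.
apply: continuous_addr; apply: continuous_mulr => //.
- by have [] := CdL i.
- by have [_ _ + _] := CdL i; apply.
Qed.

Let continuous_density2 : continuous density2.
Proof.
rewrite (_ : density2 = fun x => u x `^ (m - 2) * ((\sum_i D [:: i] x * D [:: i] x) *
      (\sum_i D [:: i] x * D [:: i] x))); last first.
  by apply/funext => x; rewrite /density2 norm_gradE expr2.
have cG : continuous (fun x => \sum_i D [:: i] x * D [:: i] x).
  by apply: continuous_sumr => i; exact: continuous_mulr.
by apply: continuous_mulr => //; exact: continuous_mulr.
Qed.

Lemma dissipation :
  - m^-1 * torus_integral A
      (fun x => u x `^ m * div (fun y => u y *: grad (laplacian u) y) x)
  + Cm m * torus_integral A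
      (fun x => u x `^ (m - 2) * euclidean_norm (grad u x) ^+ 4) <= 0.
Proof.
rewrite -(@torus_integralZ _ _ A _ (- m^-1) continuous_production).
have cm : continuous (fun x => - m^-1 * density1 x).
  by apply: continuous_mulr; [exact: cst_continuous|exact: continuous_production].
rewrite -torus_integral_linear; [|exact: cm|exact: continuous_density2].
(* The derivative is read off from the type of [CV i] by unification instead of being written out.
   Taking the index [i] in [CV i] selects the diagonal terms, whose sum is the divergence. *)
pose dV i x := (fun (f : 'rV[R]_d -> R) (df : 'I_d -> 'rV[R]_d -> R)
  (_ : periodic_C1 A f df) => df i x) _ _ (CV i).
have dV0 i : torus_integral A (dV i) = 0 := @torus_integral_partial _ _ _ hA _ _ i (CV i).
have cdV i : continuous (dV i) := @periodic_C1_continuous_partial _ _ _ _ _ (CV i) i.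
rewrite (@le_trans _ _ (torus_integral A (fun x => \sum_i dV i x)))//; last first.
  by rewrite torus_integral_sum// big1.
apply: le_torus_integral; [|exact: continuous_sumr|].
  apply: (continuous_addr cm).
  by apply: continuous_mulr; [exact: cst_continuous|exact: continuous_density2].
move=> x; rewrite divE norm_gradE.
have pm1 : u x `^ (m - 1) = u x `^ m / u x by exact: powR_pred.
have pm2 : u x `^ (m - 1 - 1) = u x `^ (m - 1) / u x by exact: powR_pred.
have -> : u x `^ (m - 2) = u x `^ (m - 1 - 1) by congr (_ `^ _); ring.
exact: (@pointwise_dissipation _ _ m (u x) (u x `^ m) _ _ (fun i => D [:: i] x)
  (fun i => dL i x) (fun i => ddL i i x) (fun i j => D [:: i; j] x)
  (fun i j => D [:: i; i; j] x) (L x) (\sum_i D [:: i] x * D [:: i] x)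
  m0 (u0 x) (powR_gt0 _ (u0 x)) pm1 pm2 erefl erefl (fun j => div_hessianE j x)).
Qed.

End dissipation.

(** * Chain rule in time, and consequences of smoothness in space and time *)

Section time_derivative_rules.
Variables (R : realType) (T : R).

Lemma dt_quotient_comp (p g : R -> R) (t a l : R) :
  is_derive (g t) 1 p a -> dt_quotient T g t --> l ->
  dt_quotient T (fun s => p (g s)) t --> a * l.
Proof.
move=> [dp vp] gl.
(* The slope of [p] at [g t], completed by its limit [a], is continuous at [g t]; this avoids
   dividing by [g s - g t] where it vanishes. *)
pose q y := if y == g t then a else (p y - p (g t)) / (y - g t).
have qc : q y @[y --> g t] --> a.
  apply/cvgrPdist_le => e e0.
  have : h^-1 *: ((p \o shift (g t)) (h *: 1) - p (g t)) @[h --> 0^'] --> a.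
    by rewrite -vp; exact: dp.
  move=> /cvgrPdist_le /(_ _ e0) /nbhs_ballP [r /= r0 H].
  apply/nbhs_ballP; exists r => //= y yr; rewrite /q.
  have [_|yg] := eqVneq y (g t); first by rewrite subrr normr0 ltW.
  have := H (y - g t); rewrite /ball /= sub0r opprB => /(_ yr).
  rewrite subr_eq0 => /(_ yg).
  have -> : (y - g t) *: (1 : R) = y - g t by exact: mulr1.
  by rewrite subrK mulrC.
have gc : g s @[s --> within `[0, T] t^'] --> g t.
  apply: (@cvg_trans _ (g s @[s --> within `[0, T] (nbhs t)])).
    by apply: cvg_app => P H; exact: (@filterS _ (nbhs t) _ _ _ (fun s Hs _ => Hs) H).
  exact: dt_continuous gl.
have H : q (g s) * ((g s - g t) / (s - t)) @[s --> within `[0, T] t^'] --> a * l.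
  exact: (cvgM (cvg_comp _ _ gc qc) gl).
apply: cvg_trans H; apply: near_eq_cvg; near=> s => /=; rewrite /q.
have [E|gs] := eqVneq (g s) (g t); first by rewrite E !subrr !mul0r mulr0.
rewrite mulrA divfK// subr_eq0//.
Unshelve. all: by end_near. Qed.

(** The space factor of the domain is everything, so only time is restricted. After swapping the
    coordinates this is the product filter that [torus_integral_dt] uses. *)
Lemma within_continuous_joint (d : nat) (v : R -> 'rV[R]_d -> R) (t : R) (x : 'rV[R]_d) :
  {within `[0, T] `*` [set: 'rV[R]_d],
    continuous (fun z : R * 'rV[R]_d => v z.1 z.2)} -> 0 <= t <= T ->
  v z.2 z.1 @[z --> (nbhs x, within `[0, T] (nbhs t))] --> v t x.
Proof.
move=> /subspace_continuousP /(_ (t, x)) H t0T.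
have {H} : v z.1 z.2 @[z --> within (`[0, T] `*` [set: 'rV[R]_d]) (nbhs (t, x))] --> v t x.
  by apply: H; split => //=; rewrite in_itv.
move=> H P /H /= [[U V] /= [tU xV] UV].
exists (V, [set s | U s /\ `[0, T]%classic s]) => /=; first split => //.
  by move: tU; apply: filterS => s Us sT.
by move=> [y s] /= [Vy [Us sT]]; apply: (UV (s, y)).
Qed.

Lemma within_continuous_section (d : nat) (v : R -> 'rV[R]_d -> R) (t : R) :
  {within `[0, T] `*` [set: 'rV[R]_d],
    continuous (fun z : R * 'rV[R]_d => v z.1 z.2)} -> 0 <= t <= T ->
  continuous (v t).
Proof.
move=> cv t0T x P /(@within_continuous_joint _ v t x cv t0T) [[U V] /= [xU tV] UV].
apply: filterS xU => y Uy; apply: (UV (y, t)); split=> //=.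
by have := nbhs_singleton tV; apply; rewrite /= in_itv.
Qed.

End time_derivative_rules.

Lemma foldr_spacetime_partial (R : realType) (d : nat) (T : R)
    (h : R -> 'rV[R]_d -> R) (s : seq 'I_d) (t : R) :
  foldr (spacetime_partial T) h (map Some s) t = foldr (@partial R d) (h t) s.
Proof. by elim: s => //= i s IH; apply/funext => x; rewrite IH. Qed.

(** Purely spatial derivatives correspond to the lists [map Some s] in [smooth]; this supplies the
    family [D] of the dissipation inequality at a fixed time. *)
Lemma smooth_periodic_C1 (R : realType) (d : nat) (A : 'M[R]_d) (T : R)
    (h : R -> 'rV[R]_d -> R) (t : R) : smooth T h -> 0 <= t <= T ->
  lattice_periodic A (h t) -> forall s,
  periodic_C1 A (foldr (@partial R d) (h t) s)
    (fun i => foldr (@partial R d) (h t) (i :: s)).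
Proof.
move=> sh t0T ph s.
have cts r : continuous (foldr (@partial R d) (h t) r).
  have [c _ _] := sh (map Some r).
  by have := within_continuous_section c t0T; rewrite foldr_spacetime_partial.
split.
- by elim: s => //= i s IH; exact: lattice_periodic_partial.
- exact: cts.
- by move=> i; exact: (cts (i :: s)).
- move=> i x; have [_ _ /(_ t x i t0T)] := sh (map Some s).
  by rewrite foldr_spacetime_partial => /derivableP.
Qed.

Theorem proposition5p6 (R : realType) (d : nat) (hd : (1 <= d)%N)
    (A : 'M[R]_d) (hA : A \in unitmx)
    (m : R) (hm : - 2^-1 <= m < 0 \/ 0 < m <= 1) :
  0 <= Cm m /\
  forall (T : R) (h : R -> 'rV[R]_d -> R),
    0 < T ->
    (forall t : R, 0 <= t <= T -> lattice_periodic A (h t)) ->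
    smooth T h ->
    (forall (t : R) (x : 'rV[R]_d), 0 <= t <= T -> 0 < h t x) ->
    (forall (t : R) (x : 'rV[R]_d), 0 <= t <= T ->
      dt T (fun s => h s x) t
        + div (fun y => h t y *: grad (laplacian (h t)) y) x = 0) ->
    forall t : R, 0 <= t <= T ->
      dt_derivable T
        (fun s => torus_integral A (fun x => h s x `^ (m + 1))) t /\
      (m * (m + 1))^-1 *
          dt T (fun s => torus_integral A (fun x => h s x `^ (m + 1))) t
        + Cm m *
          torus_integral A
            (fun x => h t x `^ (m - 2) * euclidean_norm (grad (h t) x) ^+ 4)
        <= 0.
Proof.
have m0 : m != 0 by case: hm => /andP[? ?]; [rewrite lt_eqF|rewrite gt_eqF].
have m1 : m + 1 != 0 by rewrite gt_eqF//; case: hm => /andP[? ?]; lra.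
have Cm0 : 0 <= Cm m.
  (* The roots [1] and [- 1 / 2] are the outer endpoints of the range of [m]. *)
  rewrite /Cm (_ : - 2 * m ^+ 2 + m + 1 = (1 - m) * (1 + 2 * m)); last by ring.
  by apply: mulr_ge0; [lra|apply: mulr_ge0; case: hm => /andP[? ?]; lra].
split=> // T h T0 ph sh h0 eqh t tT.
have CD := smooth_periodic_C1 sh tT (ph t tT).
have h0t x : 0 < foldr (@partial R d) (h t) [::] x by exact: h0.
pose f s x := h s x `^ (m + 1).
pose df s x := (m + 1) * h s x `^ (m + 1 - 1) * dt T (fun r => h r x) s.
(* The empty list gives joint continuity of [h] and its differentiability in time; the list
   [[:: None]] gives joint continuity of the time derivative. *)
have [hc hdt _] := sh [::]; have [hc' _ _] := sh [:: None].
have cpow (a b : R) : 0 < b -> {for b, continuous (fun r : R => r `^ a)}.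
  move=> b0; apply: differentiable_continuous; apply/derivable1_diffP.
  by have [] := is_derive1_powR a b0.
have cf s : 0 <= s <= T -> continuous (f s).
  move=> sT x; apply: (@continuous_comp _ _ _ (h s) (fun r => r `^ (m + 1))).
    exact: within_continuous_section.
  exact/cpow/h0.
have cdfj x : df z.2 z.1 @[z --> (nbhs x, within `[0, T] (nbhs t))] --> df t x.
  apply: cvgM; last exact: (@within_continuous_joint _ T _ _ t x hc' tT).
  apply: cvgMr.
  exact: (@continuous_cvg _ _ _ _ _ (fun z => h z.2 z.1) (fun r => r `^ (m + 1 - 1))
    (h t x) (cpow _ _ (h0 t x tT)) (@within_continuous_joint _ T _ _ t x hc tT)).
(* The equation trades the time derivative for the divergence, which turns [df t] into a multiple of
   the integrand in [continuous_production]. *)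
have dfE : df t = fun x => - (m + 1) *
    (h t x `^ m * div (fun y => h t y *: grad (laplacian (h t)) y) x).
  apply/funext => x; rewrite /df addrK.
  have /eqP := eqh t x tT; rewrite addr_eq0 => /eqP ->; ring.
have cp := continuous_production h0t CD.
have Dt : dt_quotient T (fun s => torus_integral A (f s)) t --> torus_integral A (df t).
  apply: torus_integral_dt => //.
  - rewrite dfE; apply: continuous_mulr; [exact: cst_continuous|exact: cp].
  - move=> s x sT; apply: (@dt_quotient_comp _ _ (fun r => r `^ (m + 1)) (fun r => h r x)).
      exact/is_derive1_powR/h0.
    exact: hdt.
split; first by apply/cvg_ex; exists (torus_integral A (df t)).
rewrite (dt_val T0 tT Dt) dfE torus_integralZ// (mulrA _ (- (m + 1))).
have -> : (m * (m + 1))^-1 * - (m + 1) = - m^-1 by field; rewrite m0 m1.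
exact: (dissipation hA m0 h0t CD).
Qed.
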